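(* Suppose that the herd coefficient satisfies $\theta>0$ and that the two households' risk aversion coefficients $\alpha_1$ and $\alpha_2$ are not equal. Then the following household's optimal investment decision $\{I_1^*(t)\}_{t\in[0,T]}$ differs from its rational investment decision $\{\bar I_1(t)\}_{t\in[0,T]}$; therefore the integral $$\int_0^Te^{2r(T-t)}[I_1^*(t)-\bar I_1(t)]^2\,dt$$ is strictly positive, and the crowding-out consumption $$\mathscr{C}:=\bar C_1(t)-C_1^*(t)=\frac{\alpha_1\sigma^2}{2}\left(\frac{\beta_1}{\alpha_1}+\frac{e^{rT}-1}{r}\right)^{-1}\int_0^Te^{2r(T-t)}[I_1^*(t)-\bar I_1(t)]^2\,dt$$ (which does not depend on $t$) is also strictly positive.
   Context: The financial market consists of one risk-free asset with interest rate $r$ and one risky asset with excess return rate $v$ and volatility $\sigma$; the time horizon is $[0,T]$. A leading household $\mathsf{H}_2$ has risk aversion coefficient $\alpha_2>0$. A following household $\mathsf{H}_1$ has risk aversion coefficient $\alpha_1>0$, diminishing marginal coefficient $\beta_1>0$, consumption weight coefficient $\gamma_1>0$ and initial fund $x_1$. The decay coefficient is $\rho>0$ and the herd coefficient is $\theta\ge0$. With investment decision $I_1$ (any sign) and consumption decision $C_1$ (assumed positive), the fund of $\mathsf{H}_1$ satisfies $dX_1(t)=[rX_1(t)+vI_1(t)-C_1(t)]\,dt+\sigma I_1(t)\,dB(t)$, $X_1(0)=x_1$, with $B$ a standard Brownian motion, and $\mathsf{H}_1$ maximizes $$\mathbb{E}\left[-\frac{1}{\alpha_1}e^{-\alpha_1X_1(T)}\right]-\frac{\gamma_1}{\beta_1}\int_0^Te^{-\rho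 rt-\beta_1C_1(t)}\,dt-\frac{\theta}{2}\int_0^Te^{\rho r(T-t)}[I_1(t)-\bar I_2(t)]^2\,dt,$$ where $\bar I_2$ is the investment decision of $\mathsf{H}_2$ and $\bar I_i(t)=\frac{v}{\alpha_i\sigma^2}e^{r(t-T)}$ for $i=1,2$. The rational decisions of $\mathsf{H}_1$ (the optimal ones when $\theta=0$) are $\bar I_1(t)$ and $\bar C_1(t)=\frac{1-\rho}{\beta_1}rt+\bar k_1$, with $$\bar k_1=\left(\frac{\beta_1}{\alpha_1}+\frac{e^{rT}-1}{r}\right)^{-1}\left[-rT+x_1e^{rT}+\frac{\ln\gamma_1}{\alpha_1}+\frac{v^2T}{2\alpha_1\sigma^2}+\frac{(\rho-1)(e^{rT}-rT-1)}{\beta_1r}\right].$$ The optimal decisions of $\mathsf{H}_1$ with herd coefficient $\theta$ are $$I_1^*(t)=\frac{\eta\alpha_2\sigma^2e^{(2-\rho)r(T-t)}+\theta}{\eta\alpha_1\sigma^2e^{(2-\rho)r(T-t)}+\theta}\cdot\bar I_2(t),\qquad C_1^*(t)=\frac{1-\rho}{\beta_1}rt+k_1^*,$$ with $$k_1^*=\bar k_1-\left(\frac{\beta_1}{\alpha_1}+\frac{e^{rT}-1}{r}\right)^{-1}\frac{\alpha_1\sigma^2}{2}\int_0^Te^{2r(T-t)}[I_1^*(t)-\bar I_1(t)]^2\,dt$$ and $$\eta=\exp\left\{-\alpha_1x_1e^{rT}-\alpha_1\int_0^Te^{r(T-t)}[vI_1^*(t)-C_1^*(t)]\,dt+\fr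ac{\alpha_1^2\sigma^2}{2}\int_0^Te^{2r(T-t)}I_1^*(t)^2\,dt\right\}.$$
   Formalization: The excess return rate v is assumed nonzero (if v = 0, all investment decisions vanish, the optimal and rational ones coincide, and the claim fails); the interest rate r is assumed nonzero so that the formulas are defined. *)

(* Defs.v *)
From Stdlib Require Import Reals.
From Coquelicot Require Import Coquelicot.
Open Scope R_scope.

(* Real parameters, shared by all the definitions:
     r       interest rate of the risk-free asset
     v       excess return rate of the risky asset
     sigma   volatility of the risky asset
     T       time horizon
     rho     decay coefficient
     theta   herd coefficient
     alpha1  risk aversion coefficient of the following household
     alpha2  risk aversion coefficient of the leading household
     beta1   diminishing marginal coefficient of the following household
     gamma1  consumption weight coefficient of the following household
     x1      initial fund of the following household
   Decisions are deterministic functions of time; only their values on [0,T]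
   matter. *)

(* The decision \bar I_i, with [alpha] the risk aversion coefficient of the
   household considered. *)
Definition rational_investment (r v sigma T alpha : R) (t : R) : R :=
  v / (alpha * sigma ^ 2) * exp (r * (t - T)).

(* (beta1 / alpha1 + (e^{rT} - 1) / r)^{-1} *)
Definition consumption_factor (r T alpha1 beta1 : R) : R :=
  / (beta1 / alpha1 + (exp (r * T) - 1) / r).

(* The constant \bar k_1. *)
Definition rational_consumption_level
    (r v sigma T rho alpha1 beta1 gamma1 x1 : R) : R :=
  consumption_factor r T alpha1 beta1 *
  (- (r * T) + x1 * exp (r * T) + ln gamma1 / alpha1
   + v ^ 2 * T / (2 * alpha1 * sigma ^ 2)
   + (rho - 1) * (exp (r * T) - r * T - 1) / (beta1 * r)).

(* The decision \bar C_1. *)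
Definition rational_consumption
    (r v sigma T rho alpha1 beta1 gamma1 x1 : R) (t : R) : R :=
  (1 - rho) / beta1 * r * t
  + rational_consumption_level r v sigma T rho alpha1 beta1 gamma1 x1.

(* e^{2r(T-t)} (I t - \bar I_1 t)^2, for an investment decision [I] of the
   following household. *)
Definition weighted_sq_deviation (r v sigma T alpha1 : R) (I : R -> R) (t : R)
    : R :=
  exp (2 * r * (T - t)) * (I t - rational_investment r v sigma T alpha1 t) ^ 2.

(* The constant k_1^*, for the optimal investment decision [I]. *)
Definition optimal_consumption_level
    (r v sigma T rho alpha1 beta1 gamma1 x1 : R) (I : R -> R) : R :=
  rational_consumption_level r v sigma T rho alpha1 beta1 gamma1 x1
  - consumption_factor r T alpha1 beta1 * (alpha1 * sigma ^ 2 / 2)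
    * RInt (weighted_sq_deviation r v sigma T alpha1 I) 0 T.

(* The number eta, for the optimal decisions [I] and [C]; it is the value of
   E[e^{- alpha1 X_1(T)}] under these decisions. *)
Definition optimal_eta (r v sigma T alpha1 x1 : R) (I C : R -> R) : R :=
  exp (- alpha1 * x1 * exp (r * T)
       - alpha1 * RInt (fun t => exp (r * (T - t)) * (v * I t - C t)) 0 T
       + alpha1 ^ 2 * sigma ^ 2 / 2
         * RInt (fun t => exp (2 * r * (T - t)) * I t ^ 2) 0 T).

(* The formulas for I_1^*, C_1^*, k_1^* and eta refer to each other, so they
   are stated as a system satisfied by the pair of decisions [I], [C]. *)
Definition optimal_decisions
    (r v sigma T rho theta alpha1 alpha2 beta1 gamma1 x1 : R) (I C : R -> R)
    : Prop :=
  let eta := optimal_eta r v sigma T alpha1 x1 I C in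
  let k := optimal_consumption_level r v sigma T rho alpha1 beta1 gamma1 x1 I in
  forall t : R, 0 <= t <= T ->
    I t =
      (eta * alpha2 * sigma ^ 2 * exp ((2 - rho) * r * (T - t)) + theta)
      / (eta * alpha1 * sigma ^ 2 * exp ((2 - rho) * r * (T - t)) + theta)
      * rational_investment r v sigma T alpha2 t
    /\ C t = (1 - rho) / beta1 * r * t + k.

(* Main.v *)
Require Import Defs.
From Stdlib Require Import Reals Lra.
From Coquelicot Require Import Coquelicot.
Open Scope R_scope.

(** With [A t = eta * sigma ^ 2 * exp ((2 - rho) * r * (T - t)) > 0], the optimal
    and rational investments differ at time [t] by
    [theta * (alpha1 - alpha2) * v * exp (r * (t - T))
     / (alpha1 * alpha2 * sigma ^ 2 * (alpha1 * A t + theta))],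
    which is continuous and vanishes nowhere when [theta > 0] and
    [alpha1 <> alpha2].  Hence the weighted squared deviation is continuous and
    positive; the consumption gap is a positive multiple of its integral, because
    [exp (r * T) - 1] has the sign of [r]. *)

(** With [eta] a free parameter, the implicit formula for the optimal investment becomes an explicit
    function of [t], defined and smooth on the whole line as soon as the denominator is positive. *)
Definition herd_investment
    (r v sigma T rho theta alpha1 alpha2 eta : R) (t : R) : R :=
  (eta * alpha2 * sigma ^ 2 * exp ((2 - rho) * r * (T - t)) + theta)
  / (eta * alpha1 * sigma ^ 2 * exp ((2 - rho) * r * (T - t)) + theta)
  * rational_investment r v sigma T alpha2 t.

Lemma herd_denominator_pos (sigma theta alpha eta : R)
    (hsigma : 0 < sigma) (htheta : 0 < theta) (halpha : 0 < alpha)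
    (heta : 0 < eta) (y : R) :
  0 < eta * alpha * sigma ^ 2 * exp y + theta.
Proof.
  apply Rplus_lt_0_compat; [|exact htheta].
  apply Rmult_lt_0_compat; [|apply exp_pos].
  apply Rmult_lt_0_compat; [|now apply pow_lt].
  now apply Rmult_lt_0_compat.
Qed.

(** Over the common denominator, the two products [eta * alpha1 * alpha2 * sigma ^ 2 * exp ((2 -
    rho) * r * (T - t))] cancel, which leaves [theta * (alpha1 - alpha2)]. *)
Lemma herd_investment_minus_rational
    (r v sigma T rho theta alpha1 alpha2 eta : R)
    (hsigma : 0 < sigma) (htheta : 0 < theta) (halpha1 : 0 < alpha1)
    (halpha2 : 0 < alpha2) (heta : 0 < eta) (t : R) :
  herd_investment r v sigma T rho theta alpha1 alpha2 eta t
  - rational_investment r v sigma T alpha1 t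
  = theta * (alpha1 - alpha2) * (v * exp (r * (t - T)))
    / (alpha1 * alpha2 * sigma ^ 2
       * (eta * alpha1 * sigma ^ 2 * exp ((2 - rho) * r * (T - t)) + theta)).
Proof.
  pose proof (herd_denominator_pos sigma theta alpha1 eta hsigma htheta halpha1
                heta ((2 - rho) * r * (T - t))) as hD.
  unfold herd_investment, rational_investment.
  field; repeat split; lra.
Qed.

Lemma herd_investment_neq_rational
    (r v sigma T rho theta alpha1 alpha2 eta : R)
    (hv : v <> 0) (hsigma : 0 < sigma) (htheta : 0 < theta)
    (halpha1 : 0 < alpha1) (halpha2 : 0 < alpha2) (heta : 0 < eta)
    (halpha : alpha1 <> alpha2) (t : R) :
  herd_investment r v sigma T rho theta alpha1 alpha2 eta t
  <> rational_investment r v sigma T alpha1 t.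
Proof.
  apply Rminus_not_eq.
  rewrite herd_investment_minus_rational by assumption.
  pose proof (herd_denominator_pos sigma theta alpha1 eta hsigma htheta halpha1
                heta ((2 - rho) * r * (T - t))) as hD.
  pose proof (exp_pos (r * (t - T))) as hE.
  pose proof (pow_lt sigma 2 hsigma) as hs.
  unfold Rdiv.
  repeat apply Rmult_integral_contrapositive_currified; try lra.
  apply Rinv_neq_0_compat.
  repeat apply Rmult_integral_contrapositive_currified; lra.
Qed.

Lemma continuous_herd_deviation
    (r v sigma T rho theta alpha1 alpha2 eta : R)
    (hsigma : 0 < sigma) (htheta : 0 < theta) (halpha1 : 0 < alpha1)
    (heta : 0 < eta) (t : R) :
  continuous
    (weighted_sq_deviation r v sigma T alpha1
       (herd_investment r v sigma T rho theta alpha1 alpha2 eta)) t.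
Proof.
  apply (ex_derive_continuous (K := R_AbsRing) (V := R_NormedModule)).
  unfold weighted_sq_deviation, herd_investment, rational_investment.
  auto_derive.
  (* The only differentiability condition left is that the denominator does not vanish. *)
  apply Rgt_not_eq, (herd_denominator_pos sigma theta alpha1 eta); assumption.
Qed.

Lemma weighted_sq_deviation_pos (r v sigma T alpha1 : R) (I : R -> R) (t : R)
    (hI : I t <> rational_investment r v sigma T alpha1 t) :
  0 < weighted_sq_deviation r v sigma T alpha1 I t.
Proof.
  apply Rmult_lt_0_compat; [apply exp_pos|].
  apply pow2_gt_0, Rminus_eq_contra, hI.
Qed.

Lemma expm1_div_pos (r T : R) (hr : r <> 0) (hT : 0 < T) :
  0 < (exp (r * T) - 1) / r.
Proof.
  destruct (Rdichotomy r 0 hr) as [hneg | hpos].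
  (* For [r < 0], changing both signs makes numerator and denominator positive. *)
  - replace ((exp (r * T) - 1) / r) with ((1 - exp (r * T)) / - r)
      by (field; exact hr).
    apply Rdiv_lt_0_compat; [|lra].
    apply Rlt_0_minus; rewrite <- exp_0; apply exp_increasing.
    rewrite <- (Rmult_0_l T); now apply Rmult_lt_compat_r.
  - apply Rdiv_lt_0_compat; [|lra].
    apply Rlt_0_minus; rewrite <- exp_0; apply exp_increasing.
    now apply Rmult_lt_0_compat.
Qed.

Lemma consumption_factor_pos (r T alpha1 beta1 : R)
    (hr : r <> 0) (hT : 0 < T) (halpha1 : 0 < alpha1) (hbeta1 : 0 < beta1) :
  0 < consumption_factor r T alpha1 beta1.
Proof.
  apply Rinv_0_lt_compat, Rplus_lt_0_compat.
  - now apply Rdiv_lt_0_compat.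
  - now apply expm1_div_pos.
Qed.

Theorem mainTheorem4
    (r v sigma T rho theta alpha1 alpha2 beta1 gamma1 x1 : R)
    (Istar Cstar : R -> R)
    (hr : r <> 0) (hv : v <> 0) (hsigma : 0 < sigma) (hT : 0 < T)
    (hrho : 0 < rho) (halpha1 : 0 < alpha1) (halpha2 : 0 < alpha2)
    (hbeta1 : 0 < beta1) (hgamma1 : 0 < gamma1)
    (hopt : optimal_decisions r v sigma T rho theta alpha1 alpha2 beta1 gamma1
              x1 Istar Cstar)
    (htheta : 0 < theta) (halpha : alpha1 <> alpha2) :
  let Ibar1 := rational_investment r v sigma T alpha1 in
  let Cbar1 := rational_consumption r v sigma T rho alpha1 beta1 gamma1 x1 in
  let deviation := fun t => exp (2 * r * (T - t)) * (Istar t - Ibar1 t) ^ 2 in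
  (exists t : R, 0 <= t <= T /\ Istar t <> Ibar1 t)
  /\ (ex_RInt deviation 0 T /\ 0 < RInt deviation 0 T)
  /\ (forall t : R, 0 <= t <= T ->
        Cbar1 t - Cstar t =
          alpha1 * sigma ^ 2 / 2
          * / (beta1 / alpha1 + (exp (r * T) - 1) / r)
          * RInt deviation 0 T
        /\ 0 < Cbar1 t - Cstar t).
Proof.
  intros Ibar1 Cbar1 deviation.
  (* The implicit system is not solved: [eta] stays the number defined by the given decisions,
     positive as an exponential. *)
  set (eta := optimal_eta r v sigma T alpha1 x1 Istar Cstar).
  assert (heta : 0 < eta) by apply exp_pos.
  set (herd := herd_investment r v sigma T rho theta alpha1 alpha2 eta).
  assert (hI : forall t, 0 <= t <= T -> Istar t = herd t)
    by (intros t ht; apply (hopt t ht)).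
  assert (hneq : forall t, herd t <> Ibar1 t)
    by (intros t; now apply herd_investment_neq_rational).
  set (herd_deviation := weighted_sq_deviation r v sigma T alpha1 herd).
  assert (hcont : forall t, continuous herd_deviation t)
    by (intros t; now apply continuous_herd_deviation).
  (* [Istar] is constrained only on [[0, T]], so [deviation] may be discontinuous at the endpoints.
     Agreement with [herd_deviation] inside the interval suffices to transfer integrability and the
     integral. *)
  assert (hdev : forall t, Rmin 0 T < t < Rmax 0 T ->
                   herd_deviation t = deviation t).
  { intros t ht.
    rewrite Rmin_left, Rmax_right in ht by lra.
    unfold herd_deviation, weighted_sq_deviation, deviation.
    now rewrite hI by lra. }
  assert (hint : 0 < RInt deviation 0 T).
  { rewrite <- (RInt_ext _ _ _ _ hdev).
    apply RInt_gt_0; [exact hT| |intros t _; apply hcont].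
    intros t _; apply weighted_sq_deviation_pos, hneq. }
  split; [|split; [split; [|exact hint]|]].
  (* Any time in [[0, T]] would do, since the two decisions differ throughout. *)
  - exists 0; split; [lra|].
    rewrite hI by lra; apply hneq.
  - apply (ex_RInt_ext _ _ _ _ hdev).
    apply (ex_RInt_continuous (V := R_CompleteNormedModule)).
    intros t _; apply hcont.
  - intros t ht.
    assert (hgap : Cbar1 t - Cstar t =
              alpha1 * sigma ^ 2 / 2 * consumption_factor r T alpha1 beta1
              * RInt deviation 0 T).
    { destruct (hopt t ht) as [_ hC].
      (* Both consumptions have the same linear term in [t] and share the rational level, so only
         the correction in [k] survives. *)
      rewrite hC; unfold Cbar1, rational_consumption, optimal_consumption_level.
      change (weighted_sq_deviation r v sigma T alpha1 Istar) with deviation.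
      ring. }
    split; [exact hgap|].
    rewrite hgap.
    apply Rmult_lt_0_compat; [|exact hint].
    apply Rmult_lt_0_compat; [|now apply consumption_factor_pos].
    pose proof (pow_lt sigma 2 hsigma) as hs.
    pose proof (Rmult_lt_0_compat _ _ halpha1 hs); lra.
Qed.
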